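(* Let $a_0(n)$ and $a_1(n)$ be convergent real sequences that satisfy, for all $n$, $2a_0(n)+a_1(n)=1$, $a_0(n)\ge 0$ and $a_0(n)+a_1(n)\ge 0$, and let $l_i=\lim_{n\to\infty}a_i(n)$, $i=0,1$. If $f''\in C[0,1]$, then $$\lim_{n\to\infty} n\left(D_n^{M,1}(f;x)-f(x)\right)=(1-2x)(2l_1+3l_0)f'(x)+x(1-x)(2l_0+l_1)f''(x)$$ uniformly on $[0,1]$.
   Context: For integers $n\ge 0$ and $k$, $p_{n,k}(x)=\binom{n}{k}x^k(1-x)^{n-k}$ for $0\le k\le n$, and $p_{n,k}(x)=0$ if $k<0$ or $k>n$. Given real sequences $a_0(n),a_1(n)$, put $a(x,n)=a_1(n)x+a_0(n)$ and, for $n\ge 1$, $$p_{n,k}^{M,1}(x)=a(x,n)\,p_{n-1,k}(x)+a(1-x,n)\,p_{n-1,k-1}(x),\quad 0\le k\le n$$ (so $p_{n,0}^{M,1}(x)=a(x,n)(1-x)^{n-1}$ and $p_{n,n}^{M,1}(x)=a(1-x,n)x^{n-1}$). The operator $D_n^{M,1}$ is $$D_n^{M,1}(f;x)=(n+1)\sum_{k=0}^{n}p_{n,k}^{M,1}(x)\int_0^1 p_{n,k}(t)f(t)\,dt,\quad x\in[0,1].$$ *)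

(* Defs.v *)
From Stdlib Require Export Reals ZArith Bool.
From Coquelicot Require Export Coquelicot.
Local Open Scope R_scope.

Definition unit_interval (x : R) : Prop := 0 <= x <= 1.

(* The explicit cut-off matters: Stdlib's [Binomial.C n k] is not 0 for k > n.
   [Binomial.C] is qualified because Coquelicot calls the complex numbers [C]. *)
Definition bernstein (n : nat) (k : Z) (x : R) : R :=
  if ((0 <=? k)%Z && (k <=? Z.of_nat n)%Z)%bool
  then Binomial.C n (Z.to_nat k) * x ^ Z.to_nat k * (1 - x) ^ (n - Z.to_nat k)
  else 0.

Definition affine (a0 a1 : nat -> R) (x : R) (n : nat) : R := a1 n * x + a0 n.

(* Meaningful for n >= 1 only: at n = 0 the truncated [n - 1] is 0. *)
Definition bernstein_M1 (a0 a1 : nat -> R) (n k : nat) (x : R) : R :=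
  affine a0 a1 x n * bernstein (n - 1) (Z.of_nat k) x
  + affine a0 a1 (1 - x) n * bernstein (n - 1) (Z.of_nat k - 1) x.

(* [sum_f_R0 u n] is u 0 + ... + u n, both ends included. *)
Definition durrmeyer_M1 (a0 a1 : nat -> R) (n : nat) (f : R -> R) (x : R) : R :=
  (INR n + 1) *
  sum_f_R0 (fun k => bernstein_M1 a0 a1 n k x *
                     RInt (fun t => bernstein n (Z.of_nat k) t * f t) 0 1) n.

Definition uniform_limit_on (D : R -> Prop) (F : nat -> R -> R) (g : R -> R)
  : Prop :=
  forall eps : R, 0 < eps ->
  exists N : nat, forall (n : nat) (x : R),
    (N <= n)%nat -> D x -> Rabs (F n x - g x) < eps.

(* Main.v *)
Require Import Defs.
From Stdlib Require Import Reals ZArith Lia Lra.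
From Coquelicot Require Import Coquelicot.
Local Open Scope R_scope.

(** Since 2 a0(n) + a1(n) = 1, the weights p_{n,k}^{M,1}(x) sum to 1 over k, and
    the two sign conditions say that the affine function a(.,n) is nonnegative
    at the endpoints 0 and 1, hence on [0,1].  So D_n is a positive linear
    operator preserving constants, and the usual Voronovskaya argument applies:
    everything is governed by the centred moments of D_n of orders 1, 2 and 4.

    Moments.  Two mechanisms make them explicit.  The inner integrals are Beta
    integrals, so the integral of p_{n,k}(t) t^r is a rising factorial of k over
    one of n ([bernstein_moment]).  The outer sum mixes the binomial mean of a
    function q(k) on n-1 trials with that of q(k+1) ([sum_bernstein_shift]).
    Pascal's rule has the same shape, which gives binomial means of falling
    factorials by a one-line induction ([bernstein_mean_falling]).
    With X = x(1-x), the resulting closed forms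
    ([durrmeyer_M1_centred_quartic]) show that n times the first centred moment
    tends to (1-2x)(2 - l0), n times the second to 2X, and that n times the
    fourth is O(1/n), all uniformly in x.  As 2 l0 + l1 = 1, the number
    2 - l0 is 2 l1 + 3 l0.

    Taylor.  Uniform continuity of f'' gives, for each eps, a K with
    |f''(u) - f''(x)| <= eps + K (u-x)^2, hence a Taylor remainder of at most
    eps (t-x)^2 + K (t-x)^4, uniformly in x ([taylor_unit]).  So f lies between
    two quartics in t - x, and positivity turns this into bounds on D_n(f;x) by
    the two exact values ([voronovskaya_error]).  After multiplication by n the
    eps term costs at most eps/2 in the limit, and all else vanishes. *)

(** * Bernstein polynomials *)

Lemma bernstein_nat (n k : nat) (x : R) (hk : (k <= n)%nat) :
  bernstein n (Z.of_nat k) x = Binomial.C n k * x ^ k * (1 - x) ^ (n - k).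
Proof.
  unfold bernstein.
  replace (0 <=? Z.of_nat k)%Z with true by (symmetry; apply Z.leb_le; lia).
  replace (Z.of_nat k <=? Z.of_nat n)%Z with true
    by (symmetry; apply Z.leb_le; lia).
  simpl. now rewrite Nat2Z.id.
Qed.

Lemma bernstein_above (n : nat) (k : Z) (x : R) (hk : (Z.of_nat n < k)%Z) :
  bernstein n k x = 0.
Proof.
  unfold bernstein.
  replace (k <=? Z.of_nat n)%Z with false by (symmetry; apply Z.leb_gt; lia).
  now rewrite Bool.andb_false_r.
Qed.

Lemma bernstein_below (n : nat) (k : Z) (x : R) (hk : (k < 0)%Z) :
  bernstein n k x = 0.
Proof.
  unfold bernstein.
  now replace (0 <=? k)%Z with false by (symmetry; apply Z.leb_gt; lia).
Qed.

Lemma binomial_pos (n k : nat) : 0 < Binomial.C n k.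
Proof.
  unfold Binomial.C. apply Rdiv_lt_0_compat; [apply INR_fact_lt_0|].
  apply Rmult_lt_0_compat; apply INR_fact_lt_0.
Qed.

Lemma bernstein_nonneg (n : nat) (k : Z) (x : R) (hx : unit_interval x) :
  0 <= bernstein n k x.
Proof.
  unfold unit_interval in hx. unfold bernstein.
  destruct (_ && _)%bool; [|lra].
  apply Rmult_le_pos; [apply Rmult_le_pos|]; try (apply pow_le; lra).
  apply Rlt_le, binomial_pos.
Qed.

(** For natural k the index k - 1 can be -1, and k can be m + 1; the cut-off in
    the definition makes the recurrence hold there too. *)
Lemma bernstein_pascal (m k : nat) (x : R) :
  bernstein (S m) (Z.of_nat k) x
  = (1 - x) * bernstein m (Z.of_nat k) x + x * bernstein m (Z.of_nat k - 1) x.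
Proof.
  destruct k as [|k].
  - rewrite (bernstein_below m (Z.of_nat 0 - 1)) by lia.
    rewrite !bernstein_nat by lia.
    unfold Binomial.C. rewrite !Nat.sub_0_r. change (INR (fact 0)) with 1. simpl (x ^ 0).
    rewrite <- tech_pow_Rmult. field. repeat split; apply INR_fact_neq_0.
  - replace (Z.of_nat (S k) - 1)%Z with (Z.of_nat k) by lia.
    destruct (lt_eq_lt_dec k m) as [[h|h]|h].
    + rewrite !bernstein_nat by lia.
      rewrite <- pascal by lia.
      replace (S m - S k)%nat with (S (m - S k)) by lia.
      replace (m - k)%nat with (S (m - S k)) by lia.
      simpl. ring.
    + subst m. rewrite (bernstein_above k (Z.of_nat (S k))) by lia.
      rewrite !bernstein_nat by lia.
      rewrite !Nat.sub_diag. unfold Binomial.C. rewrite !Nat.sub_diag.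
      change (INR (fact 0)) with 1. rewrite <- !tech_pow_Rmult. simpl ((1 - x) ^ 0).
      field. repeat split; apply INR_fact_neq_0.
    + rewrite !bernstein_above by lia. ring.
Qed.

(** * Binomial means *)

Definition bernstein_mean (m : nat) (x : R) (q : nat -> R) : R :=
  sum_f_R0 (fun k => bernstein m (Z.of_nat k) x * q k) m.

(** Both the modified basis (A = a(x), B = a(1-x)) and Pascal's rule
    (A = 1-x, B = x) have this form: the second family is the binomial weight
    moved one step to the right, so its sum is a mean of q(k+1). *)
Lemma sum_bernstein_shift (m : nat) (A B x : R) (q : nat -> R) :
  sum_f_R0 (fun k => (A * bernstein m (Z.of_nat k) x
                      + B * bernstein m (Z.of_nat k - 1) x) * q k) (S m)
  = A * bernstein_mean m x q + B * bernstein_mean m x (fun k => q (S k)).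
Proof.
  rewrite (sum_eq _
    (fun k => (bernstein m (Z.of_nat k) x * q k) * A
              + (bernstein m (Z.of_nat k - 1) x * q k) * B))
    by (intros; ring).
  rewrite sum_plus, <- !scal_sum. unfold bernstein_mean. f_equal; f_equal.
  - simpl sum_f_R0 at 1. rewrite bernstein_above by lia. ring.
  - rewrite decomp_sum by lia. simpl Nat.pred.
    rewrite bernstein_below by lia.
    rewrite Rmult_0_l, Rplus_0_l. apply sum_eq. intros i _.
    now replace (Z.of_nat (S i) - 1)%Z with (Z.of_nat i) by lia.
Qed.

Lemma bernstein_mean_succ (m : nat) (x : R) (q : nat -> R) :
  bernstein_mean (S m) x q
  = (1 - x) * bernstein_mean m x q + x * bernstein_mean m x (fun k => q (S k)).
Proof.
  rewrite <- sum_bernstein_shift. apply sum_eq. intros k _.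
  now rewrite bernstein_pascal.
Qed.

Lemma bernstein_mean_ext (m : nat) (x : R) (p q : nat -> R)
  (h : forall k, (k <= m)%nat -> p k = q k) :
  bernstein_mean m x p = bernstein_mean m x q.
Proof. apply sum_eq. intros k hk. now rewrite h. Qed.

(** The shift k -> k+1 sends the falling factorial of degree j to itself plus j
    times the one of degree j-1, so in this basis q(k+1) arises from q(k) by
    replacing each c_j by c_j + (j+1) c_{j+1}.  The induction on m therefore
    needs arbitrary coefficients. *)
Lemma bernstein_mean_falling (m : nat) (x c0 c1 c2 c3 c4 : R) :
  bernstein_mean m x
    (fun k => c0 + c1 * INR k + c2 * (INR k * (INR k - 1))
              + c3 * (INR k * (INR k - 1) * (INR k - 2))
              + c4 * (INR k * (INR k - 1) * (INR k - 2) * (INR k - 3)))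
  = c0 + c1 * (INR m * x) + c2 * (INR m * (INR m - 1) * x ^ 2)
    + c3 * (INR m * (INR m - 1) * (INR m - 2) * x ^ 3)
    + c4 * (INR m * (INR m - 1) * (INR m - 2) * (INR m - 3) * x ^ 4).
Proof.
  revert c0 c1 c2 c3 c4. induction m as [|m IH]; intros.
  - unfold bernstein_mean. simpl sum_f_R0.
    rewrite (bernstein_nat 0 0) by lia.
    unfold Binomial.C. simpl. field.
  - rewrite bernstein_mean_succ, IH.
    rewrite (bernstein_mean_ext m x (fun k => _)
      (fun k => (c0 + c1) + (c1 + 2 * c2) * INR k
                + (c2 + 3 * c3) * (INR k * (INR k - 1))
                + (c3 + 4 * c4) * (INR k * (INR k - 1) * (INR k - 2))
                + c4 * (INR k * (INR k - 1) * (INR k - 2) * (INR k - 3)))).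
    + rewrite IH, S_INR. ring.
    + intros k _. rewrite S_INR. ring.
Qed.

(** * Beta integrals *)

Lemma bernstein_mul_id (n k : nat) (t : R) (hk : (k <= n)%nat) :
  bernstein n (Z.of_nat k) t * t
  = (INR k + 1) / (INR n + 1) * bernstein (S n) (Z.of_nat (S k)) t.
Proof.
  rewrite !bernstein_nat by lia. unfold Binomial.C.
  replace (S n - S k)%nat with (n - k)%nat by lia.
  rewrite !fact_simpl, !mult_INR, !S_INR. simpl pow.
  pose proof (pos_INR n). pose proof (pos_INR k).
  field. repeat split; try apply INR_fact_neq_0; lra.
Qed.

Lemma bernstein_continuous (n k : nat) (t : R) (hk : (k <= n)%nat) :
  continuous (fun u => bernstein n (Z.of_nat k) u) t.
Proof.
  apply continuous_ext with
    (fun u => Binomial.C n k * u ^ k * (1 - u) ^ (n - k)).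
  { intro u. now rewrite bernstein_nat. }
  apply (ex_derive_continuous
    (fun u => Binomial.C n k * u ^ k * (1 - u) ^ (n - k))).
  auto_derive. easy.
Qed.

Lemma bernstein_derive (n k : nat) (t : R) (hk : (k < n)%nat) :
  is_derive (fun u => bernstein (S n) (Z.of_nat (S k)) u) t
    ((INR n + 1) * (bernstein n (Z.of_nat k) t - bernstein n (Z.of_nat (S k)) t)).
Proof.
  apply is_derive_ext with
    (fun u => Binomial.C (S n) (S k) * u ^ S k * (1 - u) ^ (S n - S k)).
  { intro u. now rewrite bernstein_nat by lia. }
  rewrite !bernstein_nat by lia.
  destruct (Nat.le_exists_sub (S k) n) as [d [-> _]]; [lia|].
  replace (S (d + S k) - S k)%nat with (S d) by lia.
  replace (d + S k - k)%nat with (S d) by lia.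
  replace (d + S k - S k)%nat with d by lia.
  auto_derive; [easy|].
  simpl Nat.pred. change (1 + - t) with (1 - t).
  unfold Binomial.C.
  replace (S (d + S k) - S k)%nat with (S d) by lia.
  replace (d + S k - k)%nat with (S d) by lia.
  replace (d + S k - S k)%nat with d by lia.
  rewrite !fact_simpl, !mult_INR, !S_INR, plus_INR, S_INR.
  simpl pow. change (match k with O => 1 | S _ => INR k + 1 end) with (INR (S k)).
  rewrite ?S_INR.
  change (match d with O => 1 | S _ => INR d + 1 end) with (INR (S d)).
  rewrite ?S_INR.
  pose proof (pos_INR d). pose proof (pos_INR k).
  field. repeat split; try apply INR_fact_neq_0; lra.
Qed.

(** By [bernstein_derive] consecutive integrals differ by the boundary values of
    p_{n+1,k+1}, which vanish at 0 and 1 for k < n; so all of them equal the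
    last one, the integral of t^n. *)
Lemma bernstein_integral (n k : nat) (hk : (k <= n)%nat) :
  is_RInt (fun t => bernstein n (Z.of_nat k) t) 0 1 (/ (INR n + 1)).
Proof.
  pose proof (pos_INR n).
  remember (n - k)%nat as d eqn:hd. revert k hk hd.
  induction d as [|d IH]; intros k hk hd.
  - assert (k = n) by lia. subst k.
    apply is_RInt_ext with (fun t => t ^ n).
    { intros t _. rewrite bernstein_nat by lia. unfold Binomial.C.
      rewrite Nat.sub_diag. simpl. field. repeat split; apply INR_fact_neq_0. }
    replace (/ (INR n + 1)) with
      (minus (1 ^ S n / (INR n + 1)) (0 ^ S n / (INR n + 1))).
    2:{ rewrite pow1, pow_i by lia. unfold minus, plus, opp; simpl.
        field. lra. }
    apply (is_RInt_derive (fun t => t ^ S n / (INR n + 1)) (fun t => t ^ n)).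
    + intros t _. auto_derive; [easy|].
      simpl Nat.pred. change (match n with O => 1 | S _ => INR n + 1 end) with (INR (S n)).
      rewrite S_INR. field. lra.
    + intros t _. apply (ex_derive_continuous (fun t => t ^ n)).
      auto_derive. easy.
  - assert (hD : is_RInt (fun t => (INR n + 1) * (bernstein n (Z.of_nat k) t
                      - bernstein n (Z.of_nat (S k)) t)) 0 1 0).
    { replace 0 with (minus (bernstein (S n) (Z.of_nat (S k)) 1)
                            (bernstein (S n) (Z.of_nat (S k)) 0)) at 2.
      2:{ rewrite !bernstein_nat by lia.
          rewrite Rminus_diag, (pow_i (S n - S k)), (pow_i (S k)) by lia.
          unfold minus, plus, opp; simpl. ring. }
      apply (is_RInt_derive (fun t => bernstein (S n) (Z.of_nat (S k)) t)).
      - intros t _. apply bernstein_derive. lia.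
      - intros t _.
        apply (continuous_scal_r (INR n + 1)
          (fun t => bernstein n (Z.of_nat k) t - bernstein n (Z.of_nat (S k)) t)).
        apply (continuous_minus (fun t => bernstein n (Z.of_nat k) t));
          apply bernstein_continuous; lia. }
    replace (/ (INR n + 1)) with
      (plus (scal (/ (INR n + 1)) 0) (/ (INR n + 1)))
      by (unfold plus, scal, mult; simpl; unfold mult; simpl; ring).
    eapply is_RInt_ext.
    2:{ refine (is_RInt_plus (V := R_NormedModule) _ _ 0 1 _ _
          (is_RInt_scal (V := R_NormedModule) _ 0 1 _ _ hD) (IH (S k) _ _)); lia. }
    intros t _. unfold plus, scal, mult; simpl; unfold mult; simpl.
    field. lra.
Qed.

(** Multiplication by t raises n and k by one ([bernstein_mul_id]), which
    reduces every moment to the integral of a single basis polynomial. *)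
Lemma bernstein_moment (r n k : nat) (hk : (k <= n)%nat) :
  is_RInt (fun t => bernstein n (Z.of_nat k) t * t ^ r) 0 1
    (INR (fact n) * INR (fact (k + r)) / (INR (fact k) * INR (fact (S (n + r))))).
Proof.
  revert n k hk. induction r as [|r IH]; intros n k hk.
  - rewrite !Nat.add_0_r.
    replace (_ / _) with (/ (INR n + 1)).
    + eapply is_RInt_ext; [|apply (bernstein_integral n k hk)].
      intros t _. simpl. now rewrite Rmult_1_r.
    + pose proof (pos_INR n).
      rewrite fact_simpl, mult_INR, S_INR. field.
      repeat split; try apply INR_fact_neq_0; lra.
  - replace (_ / _) with ((INR k + 1) / (INR n + 1)
      * (INR (fact (S n)) * INR (fact (S k + r))
         / (INR (fact (S k)) * INR (fact (S (S n + r)))))).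
    + eapply is_RInt_ext.
      2:{ refine (is_RInt_scal (V := R_NormedModule) _ 0 1 _ _
                    (IH (S n) (S k) _)). lia. }
      intros t _.
      change ((INR k + 1) / (INR n + 1)
        * (bernstein (S n) (Z.of_nat (S k)) t * t ^ r)
        = bernstein n (Z.of_nat k) t * (t * t ^ r)).
      rewrite <- !Rmult_assoc, bernstein_mul_id by assumption. ring.
    + replace (k + S r)%nat with (S k + r)%nat by lia.
      replace (n + S r)%nat with (S n + r)%nat by lia.
      pose proof (pos_INR n). pose proof (pos_INR k).
      rewrite (fact_simpl n), (fact_simpl k), !mult_INR, (S_INR n), (S_INR k).
      field. repeat split; try apply INR_fact_neq_0; lra.
Qed.

(** * The operator on quartic polynomials *)

Lemma bernstein_quartic_integral (n k : nat) (b0 b1 b2 b3 b4 : R)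
  (hk : (k <= n)%nat) :
  (INR n + 1) * RInt (fun t => bernstein n (Z.of_nat k) t
    * (b0 + b1 * t + b2 * t ^ 2 + b3 * t ^ 3 + b4 * t ^ 4)) 0 1
  = b0 + b1 * ((INR k + 1) / (INR n + 2))
    + b2 * ((INR k + 1) * (INR k + 2) / ((INR n + 2) * (INR n + 3)))
    + b3 * ((INR k + 1) * (INR k + 2) * (INR k + 3)
            / ((INR n + 2) * (INR n + 3) * (INR n + 4)))
    + b4 * ((INR k + 1) * (INR k + 2) * (INR k + 3) * (INR k + 4)
            / ((INR n + 2) * (INR n + 3) * (INR n + 4) * (INR n + 5))).
Proof.
  pose proof (pos_INR n).
  assert (hm : forall r b, is_RInt (V := R_NormedModule)
    (fun t => b * (bernstein n (Z.of_nat k) t * t ^ r)) 0 1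
    (b * (INR (fact n) * INR (fact (k + r))
          / (INR (fact k) * INR (fact (S (n + r))))))).
  { intros r b.
    exact (is_RInt_scal (V := R_NormedModule) _ 0 1 b _
             (bernstein_moment r n k hk)). }
  assert (hp : forall g h Ig Ih, is_RInt (V := R_NormedModule) g 0 1 Ig ->
    is_RInt (V := R_NormedModule) h 0 1 Ih ->
    is_RInt (V := R_NormedModule) (fun t => g t + h t) 0 1 (Ig + Ih))
    by (intros g h; apply (is_RInt_plus (V := R_NormedModule) g h)).
  pose proof (hp _ _ _ _ (hm 0%nat b0) (hp _ _ _ _ (hm 1%nat b1)
    (hp _ _ _ _ (hm 2%nat b2) (hp _ _ _ _ (hm 3%nat b3) (hm 4%nat b4))))) as hI.
  match type of hI with is_RInt ?F _ _ _ =>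
    rewrite (RInt_ext (V := R_CompleteNormedModule) _ F) end.
  2:{ intros t _.
      change (bernstein n (Z.of_nat k) t
              * (b0 + b1 * t + b2 * t ^ 2 + b3 * t ^ 3 + b4 * t ^ 4)
              = b0 * (bernstein n (Z.of_nat k) t * t ^ 0)
                + (b1 * (bernstein n (Z.of_nat k) t * t ^ 1)
                + (b2 * (bernstein n (Z.of_nat k) t * t ^ 2)
                + (b3 * (bernstein n (Z.of_nat k) t * t ^ 3)
                + b4 * (bernstein n (Z.of_nat k) t * t ^ 4))))).
      ring. }
  rewrite (is_RInt_unique (V := R_CompleteNormedModule) _ _ _ _ hI).
  replace (k + 0)%nat with k by lia. replace (k + 1)%nat with (S k) by lia.
  replace (k + 2)%nat with (S (S k)) by lia.
  replace (k + 3)%nat with (S (S (S k))) by lia.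
  replace (k + 4)%nat with (S (S (S (S k)))) by lia.
  replace (n + 0)%nat with n by lia. replace (n + 1)%nat with (S n) by lia.
  replace (n + 2)%nat with (S (S n)) by lia.
  replace (n + 3)%nat with (S (S (S n))) by lia.
  replace (n + 4)%nat with (S (S (S (S n)))) by lia.
  rewrite !fact_simpl, !mult_INR, !S_INR.
  field. repeat split; try apply INR_fact_neq_0; lra.
Qed.

(** The centred moments of orders 1, 2 and 4 in closed form.  The cubic term is
    absent because the functions that enclose f have none.  The operator
    commutes with the reflection x -> 1-x, which is why the even moments depend
    on x only through x(1-x). *)
Lemma durrmeyer_M1_centred_quartic (a0 a1 : nat -> R) (n : nat)
  (f : R -> R) (x c0 c1 c2 c4 : R)
  (hn : (1 <= n)%nat) (hsum : 2 * a0 n + a1 n = 1)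
  (hf : forall t, f t = c0 + c1 * (t - x) + c2 * (t - x) ^ 2 + c4 * (t - x) ^ 4) :
  durrmeyer_M1 a0 a1 n f x
  = c0
    + c1 * ((1 - 2 * x) * (2 - a0 n) / (INR n + 2))
    + c2 * ((2 * INR n * (x * (1 - x))
             + (16 * a0 n - 22) * (x * (1 - x)) + 6 - 4 * a0 n)
            / ((INR n + 2) * (INR n + 3)))
    + c4 * ((12 * INR n ^ 2 * (x * (1 - x)) ^ 2
             + INR n * ((288 * a0 n - 540) * (x * (1 - x)) ^ 2
                        + (144 - 72 * a0 n) * (x * (1 - x)))
             + (1368 - 1248 * a0 n) * (x * (1 - x)) ^ 2
             + (696 * a0 n - 816) * (x * (1 - x)) + 120 - 96 * a0 n)
            / ((INR n + 2) * (INR n + 3) * (INR n + 4) * (INR n + 5))).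
Proof.
  (* coefficients of f in powers of t *)
  set (b0 := c0 - c1 * x + c2 * x ^ 2 + c4 * x ^ 4).
  set (b1 := c1 - 2 * c2 * x - 4 * c4 * x ^ 3).
  set (b2 := c2 + 6 * c4 * x ^ 2).
  set (b3 := - 4 * c4 * x).
  destruct n as [|m]; [lia|].
  pose proof (pos_INR m).
  assert (ha1 : a1 (S m) = 1 - 2 * a0 (S m)) by lra.
  unfold durrmeyer_M1, bernstein_M1. replace (S m - 1)%nat with m by lia.
  rewrite scal_sum.
  set (N := INR m + 1).
  set (q := fun K => b0 + b1 * ((K + 1) / (N + 2))
    + b2 * ((K + 1) * (K + 2) / ((N + 2) * (N + 3)))
    + b3 * ((K + 1) * (K + 2) * (K + 3) / ((N + 2) * (N + 3) * (N + 4)))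
    + c4 * ((K + 1) * (K + 2) * (K + 3) * (K + 4)
            / ((N + 2) * (N + 3) * (N + 4) * (N + 5)))).
  rewrite (sum_eq _
    (fun k => (affine a0 a1 x (S m) * bernstein m (Z.of_nat k) x
               + affine a0 a1 (1 - x) (S m) * bernstein m (Z.of_nat k - 1) x)
              * q (INR k))).
  2:{ intros k hk. rewrite Rmult_assoc. f_equal.
      rewrite (RInt_ext (V := R_CompleteNormedModule) _
        (fun t => bernstein (S m) (Z.of_nat k) t
           * (b0 + b1 * t + b2 * t ^ 2 + b3 * t ^ 3 + c4 * t ^ 4))).
      2:{ intros t _. rewrite hf. unfold b0, b1, b2, b3. simpl. ring. }
      rewrite (Rmult_comm (RInt _ _ _)), bernstein_quartic_integral by exact hk.
      now rewrite S_INR. }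
  rewrite sum_bernstein_shift.
  set (d2 := b2 / ((N + 2) * (N + 3))).
  set (d3 := b3 / ((N + 2) * (N + 3) * (N + 4))).
  set (d4 := c4 / ((N + 2) * (N + 3) * (N + 4) * (N + 5))).
  set (d1 := b1 / (N + 2)).
  (* (k+1)...(k+r), then (k+2)...(k+r+1), in the falling factorial basis *)
  rewrite (bernstein_mean_ext m x (fun k => q (INR k))
    (fun k => (b0 + d1 + 2 * d2 + 6 * d3 + 24 * d4)
      + (d1 + 4 * d2 + 18 * d3 + 96 * d4) * INR k
      + (d2 + 9 * d3 + 72 * d4) * (INR k * (INR k - 1))
      + (d3 + 16 * d4) * (INR k * (INR k - 1) * (INR k - 2))
      + d4 * (INR k * (INR k - 1) * (INR k - 2) * (INR k - 3)))).
  2:{ intros k _. unfold q, d1, d2, d3, d4, N. field. repeat split; lra. }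
  rewrite (bernstein_mean_ext m x (fun k => q (INR (S k)))
    (fun k => (b0 + 2 * d1 + 6 * d2 + 24 * d3 + 120 * d4)
      + (d1 + 6 * d2 + 36 * d3 + 240 * d4) * INR k
      + (d2 + 12 * d3 + 120 * d4) * (INR k * (INR k - 1))
      + (d3 + 20 * d4) * (INR k * (INR k - 1) * (INR k - 2))
      + d4 * (INR k * (INR k - 1) * (INR k - 2) * (INR k - 3)))).
  2:{ intros k _. rewrite S_INR. unfold q, d1, d2, d3, d4, N.
      field. repeat split; lra. }
  rewrite !bernstein_mean_falling, S_INR. fold N.
  replace (INR m) with (N - 1) by (unfold N; ring).
  assert (hN : 0 < N) by (unfold N; lra). clearbody N.
  unfold affine, d1, d2, d3, d4, b0, b1, b2, b3. rewrite ha1.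
  field. repeat split; lra.
Qed.

(** * One-sided calculus on the unit interval *)

(** Composing with the retraction of the line onto [0,1] turns continuity
    relative to [0,1] into continuity at every real point, which is what the
    classical theorems on continuous functions and on integrals ask for. *)
Definition clamp (x : R) : R := Rmax 0 (Rmin x 1).

Lemma clamp_in (x : R) : unit_interval (clamp x).
Proof.
  unfold clamp, unit_interval, Rmax, Rmin.
  repeat destruct (Rle_dec _ _); lra.
Qed.

Lemma clamp_id (x : R) (hx : unit_interval x) : clamp x = x.
Proof.
  unfold unit_interval in hx. unfold clamp, Rmax, Rmin.
  repeat destruct (Rle_dec _ _); lra.
Qed.

Lemma clamp_lipschitz (x y : R) : Rabs (clamp x - clamp y) <= Rabs (x - y).
Proof.
  unfold clamp, Rmax, Rmin, Rabs.
  repeat destruct (Rle_dec _ _); repeat destruct (Rcase_abs _); lra.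
Qed.

Lemma continue_in_clamp (h : R -> R)
  (hh : forall x, unit_interval x -> continue_in h unit_interval x) (x : R) :
  continuity_pt (fun y => h (clamp y)) x.
Proof.
  intros eps heps. destruct (hh _ (clamp_in x) eps heps) as [d [hd H]].
  exists d. split; [exact hd|]. intros y [_ hy].
  change (Rabs (h (clamp y) - h (clamp x)) < eps).
  change (Rabs (y - x) < d) in hy.
  destruct (Req_dec (clamp x) (clamp y)) as [e|e].
  - rewrite e, Rminus_diag, Rabs_R0. exact heps.
  - apply (H (clamp y)). split.
    + split; [apply clamp_in|exact e].
    + apply Rle_lt_trans with (Rabs (y - x)); [apply clamp_lipschitz|exact hy].
Qed.

Lemma continue_in_bounded (h : R -> R)
  (hh : forall x, unit_interval x -> continue_in h unit_interval x) :
  exists M, 0 <= M /\ forall x, unit_interval x -> Rabs (h x) <= M.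
Proof.
  destruct (continuity_ab_maj (fun y => Rabs (h (clamp y))) 0 1) as [z [hz _]].
  - lra.
  - intros c _. apply (continuity_pt_comp (fun y => h (clamp y)) Rabs).
    + now apply continue_in_clamp.
    + apply Rcontinuity_abs.
  - exists (Rabs (h (clamp z))). split; [apply Rabs_pos|].
    intros x hx. rewrite <- (clamp_id x hx) at 1. now apply hz.
Qed.

Lemma limit1_in_subset (g : R -> R) (D E : R -> Prop) (l x : R)
  (hDE : forall y, D y -> E y) (hg : limit1_in g E l x) : limit1_in g D l x.
Proof.
  intros eps heps. destruct (hg eps heps) as [d [hd H]].
  exists d. split; [exact hd|]. intros y [hy hyd]. apply H. auto.
Qed.

(** The bound on u - x, instead of an interval with ordered endpoints, lets x and
    t come in either order and lets the lemma be chained. *)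
Lemma mean_value_unit (h h' : R -> R)
  (hh : forall x, unit_interval x -> D_in h h' unit_interval x)
  (x t : R) (hx : unit_interval x) (ht : unit_interval t) :
  exists u, unit_interval u /\ Rabs (u - x) <= Rabs (t - x)
            /\ h t - h x = h' u * (t - x).
Proof.
  unfold unit_interval in hx, ht.
  destruct (MVT_gen (fun y => h (clamp y)) x t h') as [u [hu e]].
  - intros y hy.
    assert (hy1 : 0 < y < 1).
    { revert hy. unfold Rmin, Rmax. destruct (Rle_dec _ _); lra. }
    apply is_derive_Reals, derivable_pt_lim_D_in.
    intros eps heps.
    destruct (hh y ltac:(unfold unit_interval; lra) eps heps) as [d [hd H]].
    exists (Rmin d (Rmin y (1 - y))). split; [repeat apply Rmin_pos; lra|].
    intros z [[_ hz] hzy].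
    assert (hz3 : Rabs (z - y) < Rmin d (Rmin y (1 - y))) by exact hzy.
    assert (hz1 : unit_interval z).
    { revert hz3. unfold unit_interval, Rmin, Rabs.
      repeat destruct (Rle_dec _ _); destruct (Rcase_abs _); lra. }
    rewrite (clamp_id z hz1), (clamp_id y) by (unfold unit_interval; lra).
    apply H. split; [split; assumption|].
    eapply Rlt_le_trans; [exact hzy|apply Rmin_l].
  - intros y _. apply continue_in_clamp. intros z hz.
    exact (cont_deriv _ _ _ _ (hh z hz)).
  - rewrite !clamp_id in e by assumption.
    exists u. revert hu. unfold unit_interval, Rmin, Rmax, Rabs.
    destruct (Rle_dec _ _); intro hu; repeat split; try lra;
      repeat destruct (Rcase_abs _); lra.
Qed.

(** Within the distance d of uniform continuity the increment is below eps;
    beyond it, (u-x)^2 / d^2 >= 1, so K = 2 M / d^2 absorbs the trivial bound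
    2 M, where M bounds |h|. *)
Lemma continue_in_quadratic_modulus (h : R -> R)
  (hh : forall x, unit_interval x -> continue_in h unit_interval x)
  (eps : R) (heps : 0 < eps) :
  exists K, 0 <= K /\ forall x u, unit_interval x -> unit_interval u ->
    Rabs (h u - h x) <= eps + K * (u - x) ^ 2.
Proof.
  destruct (continue_in_bounded h hh) as [M [hM hb]].
  destruct (@Heine_cor2 (fun y => h (clamp y)) 0 1
              ltac:(intros y _; now apply continue_in_clamp)
              (mkposreal eps heps))
    as [[d hd] H]; simpl in H.
  assert (hd2 : 0 < d ^ 2) by now apply pow_lt.
  exists (2 * M / d ^ 2). split.
  { apply Rmult_le_pos; [lra|]. apply Rlt_le, Rinv_0_lt_compat, hd2. }
  intros x u hx hu. pose proof (pow2_ge_0 (u - x)) as hsq.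
  destruct (Rlt_le_dec (Rabs (u - x)) d) as [hlt|hge].
  - specialize (H u x hu hx hlt). rewrite !clamp_id in H by assumption.
    assert (0 <= 2 * M / d ^ 2 * (u - x) ^ 2).
    { apply Rmult_le_pos; [|exact hsq].
      apply Rmult_le_pos; [lra|]. apply Rlt_le, Rinv_0_lt_compat, hd2. }
    lra.
  - assert (h1 : Rabs (h u - h x) <= 2 * M).
    { unfold Rminus. eapply Rle_trans; [apply Rabs_triang|].
      rewrite Rabs_Ropp. pose proof (hb u hu). pose proof (hb x hx). lra. }
    assert (h2 : d ^ 2 <= (u - x) ^ 2).
    { rewrite <- (pow2_abs (u - x)). apply pow_incr. lra. }
    assert (h3 : 2 * M = 2 * M / d ^ 2 * d ^ 2) by (field; lra).
    assert (2 * M / d ^ 2 * d ^ 2 <= 2 * M / d ^ 2 * (u - x) ^ 2).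
    { apply Rmult_le_compat_l; [|exact h2].
      apply Rmult_le_pos; [lra|]. apply Rlt_le, Rinv_0_lt_compat, hd2. }
    lra.
Qed.

(** Two mean value steps, the first for f minus its Taylor polynomial at x, the
    second for f', write the remainder as (f''(u) - f''(x)) (s-x) (t-x) with u
    and s no further from x than t is.  The lost factor 1/2 is harmless. *)
Lemma taylor_unit (f f' f'' : R -> R)
  (hf' : forall x, unit_interval x -> D_in f f' unit_interval x)
  (hf'' : forall x, unit_interval x -> D_in f' f'' unit_interval x)
  (hcont : forall x, unit_interval x -> continue_in f'' unit_interval x)
  (eps : R) (heps : 0 < eps) :
  exists K, 0 <= K /\ forall x t, unit_interval x -> unit_interval t ->
    Rabs (f t - (f x + f' x * (t - x) + f'' x / 2 * (t - x) ^ 2))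
    <= eps * (t - x) ^ 2 + K * (t - x) ^ 4.
Proof.
  destruct (continue_in_quadratic_modulus f'' hcont eps heps) as [K [hK H]].
  exists K. split; [exact hK|]. intros x t hx ht.
  set (q := fun s => f x + f' x * (s - x) + f'' x / 2 * (s - x) ^ 2).
  set (q' := fun s => f' x + f'' x * (s - x)).
  destruct (mean_value_unit (fun s => f s - q s) (fun s => f' s - q' s)) with (x := x) (t := t)
    as [s [hs [hsx e]]]; try assumption.
  { intros s hs. apply Dminus; [now apply hf'|].
    apply limit1_in_subset with (D_x no_cond s).
    { intros y [_ hy]. split; [exact I|exact hy]. }
    apply derivable_pt_lim_D_in, is_derive_Reals.
    unfold q, q'. auto_derive; [easy|]. simpl. field. }
  destruct (mean_value_unit f' f'' hf'' x s hx hs) as [u [hu [hux e']]].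
  assert (hr : f t - q t = (f'' u - f'' x) * ((s - x) * (t - x))).
  { unfold q' in e.
    replace (f t - q t) with ((f t - q t) - (f x - q x)) by (unfold q; ring).
    rewrite e. replace (f' s) with (f' x + f'' u * (s - x)) by lra. ring. }
  fold (q t). rewrite hr, !Rabs_mult.
  pose proof (H x u hx hu) as hm.
  assert (hu2 : (u - x) ^ 2 <= (t - x) ^ 2).
  { rewrite <- (pow2_abs (u - x)), <- (pow2_abs (t - x)). apply pow_incr.
    split; [apply Rabs_pos|lra]. }
  assert (hst : Rabs (s - x) * Rabs (t - x) <= (t - x) ^ 2).
  { rewrite <- (pow2_abs (t - x)). pose proof (Rabs_pos (t - x)). nra. }
  apply Rle_trans with ((eps + K * (t - x) ^ 2) * (t - x) ^ 2); [|apply Req_le; ring].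
  apply Rmult_le_compat; try assumption.
  - apply Rabs_pos.
  - apply Rmult_le_pos; apply Rabs_pos.
  - nra.
Qed.

(** * Positivity of the operator *)

Lemma durrmeyer_M1_le (a0 a1 : nat -> R) (n : nat) (g h : R -> R) (x : R)
  (hn : (1 <= n)%nat) (hpos0 : 0 <= a0 n) (hpos1 : 0 <= a0 n + a1 n)
  (hx : unit_interval x)
  (hg : forall t, unit_interval t -> continue_in g unit_interval t)
  (hh : forall t, unit_interval t -> continue_in h unit_interval t)
  (hgh : forall t, unit_interval t -> g t <= h t) :
  durrmeyer_M1 a0 a1 n g x <= durrmeyer_M1 a0 a1 n h x.
Proof.
  unfold durrmeyer_M1. pose proof (pos_INR n).
  apply Rmult_le_compat_l; [lra|].
  apply sum_Rle. intros k hk. apply Rmult_le_compat_l.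
  - unfold unit_interval in hx.
    unfold bernstein_M1, affine. apply Rplus_le_le_0_compat;
      (apply Rmult_le_pos; [nra|now apply bernstein_nonneg]).
  - assert (hint : forall p, (forall t, unit_interval t -> continue_in p unit_interval t) ->
      ex_RInt (fun t => bernstein n (Z.of_nat k) t * p t) 0 1).
    { intros p hp.
      apply ex_RInt_ext with (fun t => bernstein n (Z.of_nat k) t * p (clamp t)).
      - rewrite Rmin_left, Rmax_right by lra. intros t ht.
        rewrite clamp_id; [reflexivity|unfold unit_interval; lra].
      - apply (ex_RInt_continuous (V := R_CompleteNormedModule)). intros t _.
        apply (continuous_mult (fun t => bernstein n (Z.of_nat k) t)).
        + now apply bernstein_continuous.
        + apply continuity_pt_filterlim. now apply continue_in_clamp. }
    apply RInt_le; [lra|now apply hint|now apply hint|].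
    intros t ht. assert (unit_interval t) by (unfold unit_interval; lra).
    apply Rmult_le_compat_l; [now apply bernstein_nonneg|auto].
Qed.

(** * The limit *)

Lemma first_moment_estimate (N a l x : R) (hN : 1 <= N) (ha : 0 <= a <= 1)
  (hx : unit_interval x) :
  Rabs (N * ((1 - 2 * x) * (2 - a) / (N + 2)) - (1 - 2 * x) * (2 - l))
  <= Rabs (a - l) + 4 * / N.
Proof.
  unfold unit_interval in hx.
  replace (N * ((1 - 2 * x) * (2 - a) / (N + 2)) - (1 - 2 * x) * (2 - l))
    with ((1 - 2 * x) * ((l - a) + - (2 * (2 - a) / (N + 2)))) by (field; lra).
  rewrite Rabs_mult, (Rabs_minus_sym a l).
  assert (h1 : Rabs (1 - 2 * x) <= 1) by (apply Rabs_le; lra).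
  assert (h2 : 2 * (2 - a) / (N + 2) <= 4 * / N).
  { apply Rmult_le_compat; try lra.
    - apply Rlt_le, Rinv_0_lt_compat. lra.
    - apply Rinv_le_contravar; lra. }
  assert (h3 : 0 <= 2 * (2 - a) / (N + 2)).
  { apply Rmult_le_pos; [lra|]. apply Rlt_le, Rinv_0_lt_compat. lra. }
  pose proof (Rabs_triang (l - a) (- (2 * (2 - a) / (N + 2)))) as h4.
  rewrite Rabs_Ropp, (Rabs_pos_eq _ h3) in h4.
  pose proof (Rabs_pos ((l - a) + - (2 * (2 - a) / (N + 2)))).
  pose proof (Rabs_pos (1 - 2 * x)). nra.
Qed.

(** Here and in the next lemma X stands for x(1-x) and a for a0(n); the
    constants are crude. *)
Lemma second_moment_estimate (N a X : R) (hN : 1 <= N) (ha : 0 <= a <= 1)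
  (hX : 0 <= X <= / 4) :
  Rabs (N * ((2 * N * X + (16 * a - 22) * X + 6 - 4 * a)
             / ((N + 2) * (N + 3))) - 2 * X) <= 26 * / N.
Proof.
  assert (hd : 0 < (N + 2) * (N + 3)) by nra.
  replace (_ - _) with ((N * ((16 * a - 32) * X + 6 - 4 * a) - 12 * X)
                        / ((N + 2) * (N + 3))) by (field; lra).
  replace (26 * / N) with (26 * ((N + 2) * (N + 3)) / N / ((N + 2) * (N + 3)))
    by (field; lra).
  unfold Rdiv at 1. rewrite Rabs_mult, (Rabs_pos_eq (/ _))
    by (apply Rlt_le, Rinv_0_lt_compat, hd).
  apply Rmult_le_compat_r; [apply Rlt_le, Rinv_0_lt_compat, hd|].
  replace (26 * ((N + 2) * (N + 3)) / N)
    with (26 * N + 130 + 156 * / N) by (field; lra).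
  assert (0 < / N) by (apply Rinv_0_lt_compat; lra).
  assert (hc : -10 <= (16 * a - 32) * X + 6 - 4 * a <= 10) by nra.
  apply Rabs_le. nra.
Qed.

Lemma fourth_moment_estimate (N a X : R) (hN : 1 <= N) (ha : 0 <= a <= 1)
  (hX : 0 <= X <= / 4) :
  N * ((12 * N ^ 2 * X ^ 2
        + N * ((288 * a - 540) * X ^ 2 + (144 - 72 * a) * X)
        + (1368 - 1248 * a) * X ^ 2 + (696 * a - 816) * X + 120 - 96 * a)
       / ((N + 2) * (N + 3) * (N + 4) * (N + 5))) <= 3000 * / N.
Proof.
  (* coefficients of N and of 1 in the numerator *)
  assert (hX2 : 0 <= X ^ 2 <= / 4) by nra.
  assert (hB : (288 * a - 540) * X ^ 2 + (144 - 72 * a) * X <= 144) by nra.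
  assert (hC : (1368 - 1248 * a) * X ^ 2 + (696 * a - 816) * X + 120 - 96 * a
               <= 1500) by nra.
  set (A := 12 * N ^ 2 * X ^ 2 + _ + _ + _ + _ - _).
  assert (hA : A <= 3000 * N ^ 2).
  { assert (12 * N ^ 2 * X ^ 2 <= 3 * N ^ 2) by nra. unfold A. nra. }
  assert (hd : 0 < (N + 2) * (N + 3) * (N + 4) * (N + 5))
    by (repeat apply Rmult_lt_0_compat; lra).
  apply Rle_trans with
    (N * (3000 * N ^ 2 / ((N + 2) * (N + 3) * (N + 4) * (N + 5)))).
  { apply Rmult_le_compat_l; [lra|]. apply Rmult_le_compat_r; [|exact hA].
    apply Rlt_le, Rinv_0_lt_compat, hd. }
  replace (N * _) with
    (3000 * / N * (N ^ 4 / ((N + 2) * (N + 3) * (N + 4) * (N + 5))))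
    by (field; lra).
  rewrite <- (Rmult_1_r (3000 * / N)) at 2.
  apply Rmult_le_compat_l.
  { assert (0 < / N) by (apply Rinv_0_lt_compat; lra). lra. }
  apply Rle_div_l; [exact hd|]. rewrite Rmult_1_l.
  replace (N ^ 4) with (N * N * N * N) by ring.
  repeat apply Rmult_le_compat; repeat apply Rmult_le_pos; lra.
Qed.

(** The term eps / 2 is eps times the bound 2 x(1-x) <= 1/2 for the limit of n
    times the second moment; its deviation from that limit is the 26 eps / n. *)
Lemma voronovskaya_error (a0 a1 : nat -> R) (l0 : R) (f f' f'' : R -> R)
  (B1 B2 eps K : R) (n : nat) (x : R)
  (hn : (1 <= n)%nat) (hsum : 2 * a0 n + a1 n = 1)
  (hpos0 : 0 <= a0 n) (hpos1 : 0 <= a0 n + a1 n)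
  (hfc : forall t, unit_interval t -> continue_in f unit_interval t)
  (hx : unit_interval x)
  (hB1 : Rabs (f' x) <= B1) (hB2 : Rabs (f'' x) <= B2)
  (heps : 0 < eps) (hK : 0 <= K)
  (htaylor : forall t, unit_interval t ->
    Rabs (f t - (f x + f' x * (t - x) + f'' x / 2 * (t - x) ^ 2))
    <= eps * (t - x) ^ 2 + K * (t - x) ^ 4) :
  Rabs (INR n * (durrmeyer_M1 a0 a1 n f x - f x)
        - ((1 - 2 * x) * (2 - l0) * f' x + x * (1 - x) * f'' x))
  <= B1 * Rabs (a0 n - l0) + eps / 2
     + (4 * B1 + 13 * B2 + 26 * eps + 3000 * K) * / INR n.
Proof.
  assert (hN : 1 <= INR n) by (apply (le_INR 1); exact hn).
  assert (ha : 0 <= a0 n <= 1) by lra.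
  assert (hX : 0 <= x * (1 - x) <= / 4).
  { unfold unit_interval in hx. pose proof (pow2_ge_0 (x - / 2)).
    split; [apply Rmult_le_pos|]; lra. }
  pose proof (first_moment_estimate (INR n) (a0 n) l0 x hN ha hx) as e1.
  pose proof (second_moment_estimate (INR n) (a0 n) _ hN ha hX) as e2.
  pose proof (fourth_moment_estimate (INR n) (a0 n) _ hN ha hX) as e4.
  assert (hcp : forall c2 c4 t, continue_in (fun t => f x + f' x * (t - x)
      + c2 * (t - x) ^ 2 + c4 * (t - x) ^ 4) unit_interval t).
  { intros c2 c4 t. apply limit1_in_subset with (D_x no_cond t).
    { intros y [_ hy]. split; [exact I|exact hy]. }
    match goal with |- limit1_in ?g _ _ _ => change (continuity_pt g t) end.
    apply derivable_continuous_pt, ex_derive_Reals_0. auto_derive. easy. }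
  (* f is squeezed between two quartics on which D_n is known exactly *)
  assert (hup : durrmeyer_M1 a0 a1 n f x <= durrmeyer_M1 a0 a1 n
    (fun t => f x + f' x * (t - x) + (f'' x / 2 + eps) * (t - x) ^ 2
              + K * (t - x) ^ 4) x).
  { apply durrmeyer_M1_le; auto. intros t ht.
    pose proof (htaylor t ht) as h. apply Rabs_le_between in h. lra. }
  assert (hlo : durrmeyer_M1 a0 a1 n
    (fun t => f x + f' x * (t - x) + (f'' x / 2 - eps) * (t - x) ^ 2
              + (- K) * (t - x) ^ 4) x <= durrmeyer_M1 a0 a1 n f x).
  { apply durrmeyer_M1_le; auto. intros t ht.
    pose proof (htaylor t ht) as h. apply Rabs_le_between in h. lra. }
  rewrite (durrmeyer_M1_centred_quartic a0 a1 n _ x _ _ _ _ hn hsum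
             (fun t => eq_refl)) in hup.
  rewrite (durrmeyer_M1_centred_quartic a0 a1 n _ x _ _ _ _ hn hsum
             (fun t => eq_refl)) in hlo.
  revert e1 e2 e4 hup hlo.
  set (M1 := (1 - 2 * x) * (2 - a0 n) / (INR n + 2)).
  set (M2 := _ / ((INR n + 2) * (INR n + 3))).
  set (M4 := _ / ((INR n + 2) * (INR n + 3) * (INR n + 4) * (INR n + 5))).
  generalize (durrmeyer_M1 a0 a1 n f x). intros D e1 e2 e4 hup hlo.
  set (i := / INR n) in *.
  set (E1 := INR n * M1 - (1 - 2 * x) * (2 - l0)) in *.
  set (E2 := INR n * M2 - 2 * (x * (1 - x))) in *.
  assert (hi : 0 < i) by (apply Rinv_0_lt_compat; lra).
  assert (p1 : Rabs (f' x * E1) <= B1 * (Rabs (a0 n - l0) + 4 * i)).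
  { rewrite Rabs_mult. apply Rmult_le_compat; auto using Rabs_pos. }
  assert (p2 : Rabs (f'' x / 2 * E2) <= B2 / 2 * (26 * i)).
  { rewrite Rabs_mult. apply Rmult_le_compat; auto using Rabs_pos.
    unfold Rdiv. rewrite Rabs_mult, (Rabs_pos_eq (/ 2)) by lra. lra. }
  assert (p3 : eps * (INR n * M2) <= eps * (/ 2 + 26 * i)).
  { apply Rmult_le_compat_l; [lra|]. apply Rabs_le_between in e2.
    unfold E2 in e2. lra. }
  assert (p4 : K * (INR n * M4) <= K * (3000 * i))
    by (apply Rmult_le_compat_l; assumption).
  apply Rabs_le_between in p1, p2.
  apply (Rmult_le_compat_l (INR n)) in hup, hlo; try lra.
  apply Rabs_le. unfold E1, E2 in p1, p2. lra.
Qed.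

(* [D_in] and [continue_in] are relative to [0,1], hence one-sided at 0 and 1. *)
Theorem theorem2p4 (a0 a1 : nat -> R) (l0 l1 : R) (f f' f'' : R -> R)
  (ha0 : is_lim_seq a0 (Finite l0))
  (ha1 : is_lim_seq a1 (Finite l1))
  (hsum : forall n : nat, 2 * a0 n + a1 n = 1)
  (hpos0 : forall n : nat, 0 <= a0 n)
  (hpos1 : forall n : nat, 0 <= a0 n + a1 n)
  (hf' : forall x : R, unit_interval x -> D_in f f' unit_interval x)
  (hf'' : forall x : R, unit_interval x -> D_in f' f'' unit_interval x)
  (hcont : forall x : R, unit_interval x -> continue_in f'' unit_interval x) :
  uniform_limit_on unit_interval
    (fun n x => INR n * (durrmeyer_M1 a0 a1 n f x - f x))
    (fun x => (1 - 2 * x) * (2 * l1 + 3 * l0) * f' x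
              + x * (1 - x) * (2 * l0 + l1) * f'' x).
Proof.
  assert (hl : 2 * l0 + l1 = 1).
  { assert (h : is_lim_seq (fun n => 2 * a0 n + a1 n) (2 * l0 + l1)).
    { apply is_lim_seq_plus'; [|exact ha1].
      exact (is_lim_seq_scal_l a0 2 l0 ha0). }
    apply (is_lim_seq_ext _ (fun _ => 1) _ hsum), is_lim_seq_unique in h.
    rewrite Lim_seq_const in h. now injection h. }
  intros eps heps.
  destruct (continue_in_bounded f') as [B1 [hB1 hf'b]].
  { intros x hx. exact (cont_deriv _ _ _ _ (hf'' x hx)). }
  destruct (continue_in_bounded f'' hcont) as [B2 [hB2 hf''b]].
  destruct (taylor_unit f f' f'' hf' hf'' hcont eps heps) as [K [hK hT]].
  set (Q := 4 * B1 + 13 * B2 + 26 * eps + 3000 * K).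
  assert (hQ : 0 < Q) by (unfold Q; lra).
  assert (hdel : 0 < eps / (4 * (B1 + 1))) by (apply Rdiv_lt_0_compat; lra).
  apply is_lim_seq_spec in ha0. destruct (ha0 (mkposreal _ hdel)) as [N1 hN1].
  simpl in hN1.
  destruct (archimed_cor1 (eps / (4 * Q))) as [N2 [hN2 hN2pos]].
  { apply Rdiv_lt_0_compat; lra. }
  exists (Nat.max N1 N2). intros n x hn hx.
  replace ((1 - 2 * x) * (2 * l1 + 3 * l0) * f' x
           + x * (1 - x) * (2 * l0 + l1) * f'' x)
    with ((1 - 2 * x) * (2 - l0) * f' x + x * (1 - x) * f'' x)
    by (rewrite hl; replace l1 with (1 - 2 * l0) by lra; ring).
  eapply Rle_lt_trans.
  { apply (voronovskaya_error a0 a1 l0 f f' f'' B1 B2 eps K n x);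
      auto; try lia.
    intros t ht. exact (cont_deriv _ _ _ _ (hf' t ht)). }
  fold Q.
  assert (h1 : B1 * Rabs (a0 n - l0) <= eps / 4).
  { apply Rle_trans with ((B1 + 1) * (eps / (4 * (B1 + 1)))).
    - apply Rmult_le_compat; [lra|apply Rabs_pos|lra|].
      apply Rlt_le, hN1. lia.
    - apply Req_le. field. lra. }
  assert (h2 : Q * / INR n < eps / 4).
  { replace (eps / 4) with (Q * (eps / (4 * Q))) by (field; lra).
    apply Rmult_lt_compat_l; [exact hQ|].
    apply Rle_lt_trans with (/ INR N2); [|exact hN2].
    apply Rinv_le_contravar; [now apply lt_0_INR|apply le_INR; lia]. }
  lra.
Qed.
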